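(* For every prime $p > 2.67\times 10^{32}$, the least primitive root $g(p)$ modulo $p$ satisfies $g(p) < p^{0.6309}$.
   Context: For a prime $p$, $g(p)$ denotes the least positive integer that is a primitive root modulo $p$, i.e. a generator of the multiplicative group $(\mathbb{Z}/p\mathbb{Z})^\times$. *)

(* Defs.v *)
From Stdlib Require Import Arith ZArith Znumtheory Reals.

(* g is a primitive root modulo p: g is invertible mod p and its
   multiplicative order modulo p is p - 1, i.e. g generates
   (Z/pZ)^x (which has p - 1 elements for p prime). *)
Local Open Scope nat_scope.
Definition is_primitive_root (p g : nat) : Prop :=
  Nat.gcd g p = 1 /\
  (g ^ (p - 1)) mod p = 1 mod p /\
  (forall k : nat, 1 <= k -> k < p - 1 -> (g ^ k) mod p <> 1).

Definition least_primitive_root (p g : nat) : Prop :=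
  1 <= g /\ is_primitive_root p g /\
  (forall h : nat, 1 <= h -> h < g -> ~ is_primitive_root p h).

(* Main.v *)
Require Import Defs.
From mathcomp Require Import all_boot all_order all_algebra all_fingroup all_solvable.
From mathcomp Require Import all_field all_character.
From mathcomp Require Import ring lra zify.

(** Let [m = p - 1] and let [e] be a product of some of the primes dividing [m]
    (the small ones); let [q_1, ..., q_s] be the remaining ones.  Let [A_0] be
    the set of residues that are [r]-th powers for no prime [r] dividing [e], and
    [A_j] the set of [q_j]-th powers in [A_0].  An element of [A_0] outside all
    the [A_j] is a primitive root.

    Each of these sets [A] is a union of cosets of a subgroup [L] of [F_p^*] with
    [|A| = phi(e) |L|], so its additive Fourier transform is [L]-invariant, and
    Parseval bounds every nonzero coefficient by [sqrt (p |A| / |L|) =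
    sqrt (p phi(e))]; no multiplicative character is needed.  Hence the number
    of pairs [(y, z)] in [{1..N}^2] with [y + z] in [A] is [N^2 |A| / p] up to
    an error of at most [(N - N^2 / p) sqrt (p phi(e))], without a logarithm.  If
    [1/q_1 + ... + 1/q_s <= 1 - 1/d] and [N^2 phi(e) > ((s + 1) d e)^2 p], the
    main terms win and there is a primitive root at most [2 N].

    This yields a primitive root below [p^(5/8)].  If [m] has at most 41 prime
    factors, take for [e] the product of those among 2, 3, 5 and [d = 11].
    Otherwise take the smallest seventh of the prime factors, so that [e^7 <= p],
    and [d = 5]; the sum of the reciprocals of the others is controlled because
    primes above 3 are coprime to 6. *)

Set Implicit Arguments. Unset Strict Implicit. Unset Printing Implicit Defensive.
Import Order.TTheory GRing.Theory Num.Theory.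

Local Open Scope ring_scope.

(** * Sums of two elements of a set, by Fourier analysis *)

Definition additive_char (V : zmodType) (psi : V -> algC) : Prop :=
  [/\ psi 0 = 1, {morph psi : x y / x + y >-> x * y} & {morph psi : x / - x >-> x^*}].

Lemma exists_nontrivial_additive_char (V : finZmodType) : (1 < #|V|)%N ->
  exists2 psi : V -> algC, additive_char psi & exists x, psi x != 1.
Proof.
move=> V1; have abV : abelian [set: V].
  by apply/centsP => x _ y _; exact: addrC.
have irr1 : (1 < Nirr [set: V])%N.
  by rewrite NirrE (eqP (etrans (esym (card_classes_abelian _)) abV)) cardsT.
pose chi := 'chi_(Ordinal irr1).
have chi_lin : chi \is a linear_char by apply: char_abelianP.
exists chi; first split.
- exact: lin_char1 chi_lin.
- by move=> x y; apply: lin_charM; rewrite ?inE.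
- by move=> x; apply: lin_charV_conj; rewrite ?inE.
apply/existsP; apply: contraT; rewrite negb_exists => /forallP chi1.
have := irr_eq1 (Ordinal irr1); rewrite -/chi => /negbT/eqP[].
by apply/cfunP => x; rewrite cfun1E inE; apply/eqP; rewrite -[_ == _]negbK chi1.
Qed.

Section Fourier.

Variables (F : finFieldType) (psi : F -> algC).
Hypotheses (psi_char : additive_char psi) (psi_nontrivial : exists x, psi x != 1).

Let psi0 : psi 0 = 1. Proof. by case: psi_char. Qed.
Let psiD : {morph psi : x y / x + y >-> x * y}. Proof. by case: psi_char. Qed.
Let psiN : {morph psi : x / - x >-> x^*}. Proof. by case: psi_char. Qed.

Lemma sum_additive_char (x : F) : \sum_t psi (t * x) = #|F|%:R *+ (x == 0).
Proof.
have [->|x0] := eqVneq x 0.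
  by under eq_bigr => t _ do rewrite mulr0 psi0; rewrite sumr_const.
have [y psiy] := psi_nontrivial; set S := \sum_t _.
have /eqP : S * psi y = S.
  rewrite mulr_suml [RHS](reindex_inj (addIr (y / x))) /=.
  by apply: eq_bigr => t _; rewrite mulrDl divfK // psiD.
by rewrite -subr_eq0 -{2}[S]mulr1 -mulrBr mulf_eq0 subr_eq0 (negPf psiy) orbF => /eqP.
Qed.

Definition fourier (f : F -> algC) (t : F) : algC := \sum_x f x * psi (t * x).

Definition convolution (f g : F -> algC) (x : F) : algC := \sum_y f y * g (x - y).

Definition indicator (A : {set F}) (x : F) : algC := (x \in A)%:R.

Lemma parseval (f g : F -> algC) :
  \sum_t fourier f t * (fourier g t)^* = #|F|%:R * \sum_x f x * (g x)^*.
Proof.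
transitivity (\sum_t \sum_x \sum_y f x * (g y)^* * psi (t * (x - y))).
  apply: eq_bigr => t _; rewrite /fourier rmorph_sum mulr_suml.
  apply: eq_bigr => x _; rewrite mulr_sumr; apply: eq_bigr => y _.
  by rewrite rmorphM /= -psiN mulrBr psiD mulrACA.
rewrite exchange_big mulr_sumr; apply: eq_bigr => x _ /=.
rewrite exchange_big (bigD1 x) //= [X in _ + X]big1 => [|y yx].
  by rewrite -mulr_sumr sum_additive_char subrr eqxx addr0 mulrC.
by rewrite -mulr_sumr sum_additive_char subr_eq0 eq_sym (negPf yx) mulr0.
Qed.

Lemma fourier_convolution (f g : F -> algC) (t : F) :
  fourier (convolution f g) t = fourier f t * fourier g t.
Proof.
rewrite /fourier /convolution mulr_suml; under eq_bigr do rewrite mulr_suml.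
rewrite exchange_big; apply: eq_bigr => y _ /=.
rewrite mulr_sumr (reindex_inj (addrI y)); apply: eq_bigr => z _ /=.
by rewrite addrC addKr mulrDr psiD mulrACA.
Qed.

Lemma sum_mul_convolution (h f g : F -> algC) :
  \sum_x h x * convolution f g x = \sum_y \sum_z f y * g z * h (y + z).
Proof.
rewrite /convolution; under eq_bigr do rewrite mulr_sumr.
rewrite exchange_big; apply: eq_bigr => y _ /=.
rewrite (reindex_inj (addrI y)); apply: eq_bigr => z _ /=.
by rewrite (addrC y) addrK mulrC.
Qed.

Lemma sum_indicator (A : {set F}) : \sum_x indicator A x = #|A|%:R.
Proof. by rewrite -sumr_const [RHS]big_mkcond; apply: eq_bigr => x _; rewrite -mulrb. Qed.

Lemma fourier_indicator0 (A : {set F}) : fourier (indicator A) 0 = #|A|%:R.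
Proof.
by rewrite -sum_indicator; apply: eq_bigr => x _; rewrite mul0r psi0 mulr1.
Qed.

Lemma parseval_indicator (A : {set F}) :
  \sum_t `|fourier (indicator A) t| ^+ 2 = #|F|%:R * #|A|%:R.
Proof.
under eq_bigr do rewrite normCK.
rewrite parseval -sum_indicator; congr (_ * _); apply: eq_bigr => x _.
by rewrite conjC_nat -natrM mulnb andbb.
Qed.

Definition mul_invariant (L A : {set F}) : Prop :=
  forall l x, l \in L -> (l * x \in A) = (x \in A).

Lemma fourier_indicatorM (L A : {set F}) (l t : F) :
  mul_invariant L A -> l \in L -> l != 0 ->
  fourier (indicator A) (l * t) = fourier (indicator A) t.
Proof.
move=> LA lL l0; rewrite [RHS](reindex_inj (mulfI l0)).
by apply: eq_bigr => x _; rewrite /indicator LA // mulrCA mulrA.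
Qed.

(* The coefficients at the [#|L|] points [l * t] are equal, so that Parseval bounds each one. *)
Lemma fourier_indicator_le (L A : {set F}) (t : F) :
  0 \notin L -> mul_invariant L A -> t != 0 ->
  #|L|%:R * `|fourier (indicator A) t| ^+ 2 <= #|F|%:R * #|A|%:R.
Proof.
move=> L0 LA t0; have Lneq0 l : l \in L -> l != 0.
  by move=> lL; apply: contraNneq L0 => <-.
pose sqn u := `|fourier (indicator A) u| ^+ 2.
have -> : #|L|%:R * sqn t = \sum_(u in [set l * t | l in L]) sqn u.
  rewrite big_imset /= => [|x y _ _ /(mulIf t0)//].
  rewrite mulr_natl -sumr_const; apply: eq_bigr => l lL.
  by rewrite /sqn (fourier_indicatorM _ LA) // Lneq0.
rewrite -parseval_indicator [leRHS](bigID (mem [set l * t | l in L])) /= lerDl.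
by apply: sumr_ge0 => u _; rewrite exprn_ge0.
Qed.

Definition sum_count (I A : {set F}) : nat :=
  (\sum_(y in I) \sum_(z in I) ((y + z)%R \in A))%N.

Lemma sum_count_fourier (I A : {set F}) :
  #|F|%:R * (sum_count I A)%:R =
  \sum_t fourier (indicator A) t * (fourier (indicator I) t)^* ^+ 2.
Proof.
pose II := convolution (indicator I) (indicator I).
transitivity (\sum_t fourier (indicator A) t * (fourier II t)^*); last first.
  by apply: eq_bigr => t _; rewrite fourier_convolution rmorphM.
rewrite parseval; congr (_ * _).
have II_real x : (II x)^* = II x.
  by rewrite rmorph_sum; apply: eq_bigr => y _; rewrite rmorphM /= !conjC_nat.
under [RHS]eq_bigr do rewrite II_real.
rewrite sum_mul_convolution natr_sum big_mkcond; apply: eq_bigr => y _ /=.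
rewrite natr_sum big_mkcond -mulrb -mulr_natl mulr_sumr; apply: eq_bigr => z _ /=.
by rewrite -mulrb -[_ *+ (z \in I)]mulr_natl mulrA.
Qed.

End Fourier.

Lemma sum_count_bound (F : finFieldType) (L A I : {set F}) :
  0 \notin L -> (0 < #|L|)%N -> mul_invariant L A ->
  `| #|F|%:R * (sum_count I A)%:R - #|I|%:R ^+ 2 * #|A|%:R | <=
    sqrtC (#|F|%:R * #|A|%:R / #|L|%:R) * (#|F|%:R * #|I|%:R - #|I|%:R ^+ 2) :> algC.
Proof.
move=> L0 L_gt0 LA.
have [psi psiP psi1] := exists_nontrivial_additive_char (finNzRing_gt1 F).
rewrite (sum_count_fourier psiP psi1) (bigD1 0) //= !(fourier_indicator0 psiP) conjC_nat.
rewrite [#|A|%:R * _]mulrC addrAC subrr add0r.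
apply: le_trans (ler_norm_sum _ _ _) _.
rewrite -(parseval_indicator psiP psi1 I) [X in _ * (X - _)](bigD1 0) //=.
rewrite (fourier_indicator0 psiP) normr_nat [X in _ * X]addrAC subrr add0r mulr_sumr.
apply: ler_sum => t t0; rewrite normrM normrX norm_conjC ler_wpM2r ?exprn_ge0 //.
rewrite -(@ler_pXn2r _ 2) ?nnegrE ?sqrtC_ge0 ?divr_ge0 ?mulr_ge0 // sqrtCK.
by rewrite ler_pdivlMr ?ltr0n // mulrC fourier_indicator_le.
Qed.

(** * Sets defined by the discrete logarithm *)

Definition periodic (T : Type) (D : nat) (f : nat -> T) : Prop :=
  forall i, f (i + D)%N = f i.

Lemma periodic_modn (T : Type) (D : nat) (f : nat -> T) (i : nat) :
  periodic D f -> f (i %% D)%N = f i.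
Proof.
move=> per; rewrite [in RHS](divn_eq i D); elim: (i %/ D)%N => [|k ->]; first by rewrite mul0n.
by rewrite mulSnr addnAC per.
Qed.

Lemma periodic_eq_mod (T : Type) (D : nat) (f : nat -> T) (i j : nat) :
  periodic D f -> i = j %[mod D] -> f i = f j.
Proof. by move=> per ij; rewrite -(periodic_modn i per) ij periodic_modn. Qed.

Lemma periodic_dvdl (T : Type) (D m : nat) (f : nat -> T) :
  (D %| m)%N -> periodic D f -> periodic m f.
Proof.
by move=> Dm per i; apply: periodic_eq_mod per _; rewrite -modnDmr (eqP Dm) addn0.
Qed.

Lemma periodic_dvdn (q : nat) : periodic q (dvdn q).
Proof. by move=> i; rewrite dvdn_addl. Qed.

Lemma periodic_coprime (e : nat) : periodic e (coprime e).
Proof. by move=> i; rewrite /coprime gcdnDr. Qed.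

Lemma sum_periodic (f : nat -> nat) (D k : nat) : periodic D f ->
  (\sum_(0 <= i < k * D) f i = k * \sum_(0 <= i < D) f i)%N.
Proof.
move=> per; elim: k => [|k IHk]; first by rewrite !mul0n big_geq.
rewrite !mulSnr (@big_cat_nat _ _ _ (k * D)) ?leq_addr //= IHk; congr (_ + _)%N.
rewrite -{1}[(k * D)%N]add0n big_addn addKn; apply: eq_bigr => i _.
by apply: periodic_eq_mod per _; rewrite addnC modnMDl.
Qed.

Lemma sum_multiples (f : nat -> nat) (q e : nat) : (0 < q)%N ->
  (\sum_(0 <= i < e * q) (q %| i) * f i = \sum_(0 <= j < e) f (j * q))%N.
Proof.
case: q => // q _; elim: e => [|e IHe]; first by rewrite !big_geq.
rewrite mulSnr (@big_cat_nat _ _ _ (e * q.+1)) ?leq_addr //= IHe big_nat_recr //=.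
congr (_ + _)%N; rewrite -{1}[(e * q.+1)%N]add0n big_addn addKn.
rewrite big_nat_recl // dvdn_mull // mul1n big1_seq ?addn0 // => i.
by rewrite mem_index_iota => iq; rewrite dvdn_addl ?dvdn_mull // gtnNdvd.
Qed.

Lemma sum_multiples_coprime (e q : nat) : (0 < q)%N -> coprime e q ->
  (\sum_(0 <= i < e * q) ((q %| i) && coprime e i) = totient e)%N.
Proof.
move=> q_gt0 eq; under eq_bigr => i _ do rewrite -mulnb.
rewrite sum_multiples // totient_count_coprime.
by apply: eq_bigr => j _; rewrite coprimeMr eq andbT.
Qed.

Lemma expf_card_pred (F : finFieldType) (x : F) : x != 0 -> x ^+ #|F|.-1 = 1.
Proof.
move=> x0; apply/eqP; rewrite -(inj_eq (mulfI x0)) -exprS prednK ?mulr1 ?expf_card //.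
by rewrite ltnW // finNzRing_gt1.
Qed.

Lemma finField_prim_root (F : finFieldType) : exists g : F, (#|F|.-1).-primitive_root g.
Proof.
have F_gt1 : (0 < #|F|.-1)%N by rewrite -subn1 subn_gt0 finNzRing_gt1.
have /hasP[g _ gP] : has (#|F|.-1).-primitive_root (enum [set~ (0 : F)]); last by exists g.
apply: has_prim_root; rewrite ?enum_uniq -?cardE ?cardsC1 //.
apply/allP => x; rewrite mem_enum in_setC1 unity_rootE => x0.
by rewrite expf_card_pred.
Qed.

Section ExponentSets.

Variables (F : finFieldType) (g : F).
Let m := #|F|.-1.
Hypothesis g_prim : m.-primitive_root g.

Let m_gt0 : (0 < m)%N. Proof. exact: prim_order_gt0 g_prim. Qed.

Lemma prim_root_exp_surj (x : F) : x != 0 -> exists i : 'I_m, x = g ^+ i.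
Proof. by move=> /expf_card_pred/(prim_rootP g_prim)[i ->]; exists i. Qed.

Definition exp_set (P : pred nat) : {set F} := [set g ^+ i | i : 'I_m & P i].

Lemma exp_set_exp (P : pred nat) (x : F) : x \in exp_set P -> exists i, x = g ^+ i.
Proof. by case/imsetP => i _ ->; exists i. Qed.

Lemma zero_notin_exp_set (P : pred nat) : 0 \notin exp_set P.
Proof.
apply/imsetP => -[i _ /esym/eqP]; rewrite expf_eq0 => /andP[_ /eqP g0].
by have /eqP := prim_expr_order g_prim; rewrite g0 expr0n gtn_eqF // eq_sym oner_eq0.
Qed.

Lemma mem_exp_set (P : pred nat) (i : nat) : periodic m P -> (g ^+ i \in exp_set P) = P i.
Proof.
move=> per; apply/imsetP/idP => [[j Pj /eqP]|Pi].
  rewrite (eq_prim_root_expr g_prim) => /eqP/(periodic_eq_mod per) ->.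
  by rewrite inE in Pj.
exists (Ordinal (ltn_pmod i m_gt0)); last by rewrite /= (prim_expr_mod g_prim).
by rewrite inE /= periodic_modn.
Qed.

Lemma card_exp_set (P : pred nat) (D : nat) : (D %| m)%N -> periodic D P ->
  #|exp_set P| = (m %/ D * \sum_(0 <= i < D) P i)%N.
Proof.
move=> Dm per; rewrite card_in_imset => [|i j _ _ /eqP]; last first.
  by rewrite (eq_prim_root_expr g_prim) !modn_small // => /eqP/val_inj.
rewrite -sum_periodic => [|i]; last by rewrite per.
rewrite divnK // big_mkord -sum1_card big_mkcond.
by apply: eq_bigr => i _; rewrite inE; case: (P i).
Qed.

Lemma card_exp_set_dvdn (D : nat) : (D %| m)%N -> #|exp_set (dvdn D)| = (m %/ D)%N.
Proof.
move=> Dm; rewrite (card_exp_set Dm (@periodic_dvdn D)).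
have := sum_multiples_coprime (dvdn_gt0 m_gt0 Dm) (coprime1n D).
under eq_bigr do rewrite coprime1n andbT.
by rewrite mul1n => ->; rewrite muln1.
Qed.

Lemma exp_set_mul_invariant (P : pred nat) (D : nat) :
  (D %| m)%N -> periodic D P -> mul_invariant (exp_set (dvdn D)) (exp_set P).
Proof.
move=> Dm per l x /[dup] /exp_set_exp[j ->].
rewrite mem_exp_set => [Dj|]; last exact: periodic_dvdl Dm (@periodic_dvdn D).
have [->|/prim_root_exp_surj[i ->]] := eqVneq x 0; first by rewrite mulr0.
have perm := periodic_dvdl Dm per.
rewrite -exprD !mem_exp_set //; apply: periodic_eq_mod per _.
by rewrite -modnDml (eqP Dj).
Qed.

(* The ratio of [exp_set P] to the subgroup of [D]-th powers is the number of
   solutions of [P] in a period. *)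
Lemma exp_set_sum_count_bound (P : pred nat) (D f : nat) (I : {set F}) :
  (D %| m)%N -> periodic D P -> (\sum_(0 <= i < D) P i = f)%N ->
  `| #|F|%:R * (sum_count I (exp_set P))%:R - #|I|%:R ^+ 2 * (m %/ D * f)%:R | <=
    sqrtC (#|F| * f)%:R * (#|F|%:R * #|I|%:R - #|I|%:R ^+ 2) :> algC.
Proof.
move=> Dm per sumP; have card_powers := card_exp_set_dvdn Dm.
have powers_gt0 : (0 < #|exp_set (dvdn D)|)%N.
  by rewrite card_powers divn_gt0 ?(dvdn_gt0 m_gt0 Dm) // dvdn_leq.
have := sum_count_bound I (zero_notin_exp_set _) powers_gt0 (exp_set_mul_invariant Dm per).
rewrite (card_exp_set Dm per) sumP card_powers.
have -> : #|F|%:R * (m %/ D * f)%:R / (m %/ D)%:R = (#|F| * f)%:R :> algC.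
  by rewrite !natrM mulrC mulrCA mulKf // pnatr_eq0 -card_powers -lt0n.
by [].
Qed.

End ExponentSets.

(** * The sieve for primitive roots *)

Definition sieve_split (m e : nat) (qs : seq nat) : Prop :=
  [/\ (e %| m)%N, {in qs, forall q, (q %| m)%N && coprime e q}
    & forall q, prime q -> (q %| m)%N -> (q %| e)%N || (q \in qs)].

Lemma sieve_split_has_dvdn (m e : nat) (qs : seq nat) (i : nat) :
  (0 < m)%N -> sieve_split m e qs -> coprime e i -> ~~ coprime i m -> has (dvdn^~ i) qs.
Proof.
move=> m_gt0 [_ _ cover] ei im; pose q := pdiv (gcdn i m).
have q_prime : prime q.
  by rewrite pdiv_prime // ltn_neqAle eq_sym im gcdn_gt0 m_gt0 orbT.
have /andP[qi qm] : (q %| i)%N && (q %| m)%N by rewrite -dvdn_gcd pdiv_dvd.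
have /orP[qe|q_qs] := cover q q_prime qm; last by apply/hasP; exists q.
have : (q %| gcdn e i)%N by rewrite dvdn_gcd qe.
by rewrite (eqP ei) dvdn1 => /eqP q1; rewrite q1 in q_prime.
Qed.

Section PrimitiveRootSieve.

Variables (F : finFieldType) (g : F) (e : nat) (qs : seq nat) (I : {set F}).
Let m := #|F|.-1.
Hypotheses (g_prim : m.-primitive_root g) (split : sieve_split m e qs).

Let m_gt0 : (0 < m)%N. Proof. exact: prim_order_gt0 g_prim. Qed.
Let e_dvd : (e %| m)%N. Proof. by case: split. Qed.
Let e_gt0 : (0 < e)%N. Proof. exact: dvdn_gt0 e_dvd. Qed.
Let q_dvd q : q \in qs -> (q %| m)%N.
Proof. by case: split => _ qsP _ /qsP/andP[]. Qed.
Let coprime_eq q : q \in qs -> coprime e q.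
Proof. by case: split => _ qsP _ /qsP/andP[]. Qed.
Let eq_dvd q : q \in qs -> (e * q %| m)%N.
Proof. by move=> q_qs; rewrite Gauss_dvd ?coprime_eq // e_dvd q_dvd. Qed.

Definition sifted_set : {set F} := exp_set g (coprime e).

Definition sifted_powers (q : nat) : {set F} :=
  exp_set g [pred i | (q %| i)%N && coprime e i].

Let sifted_powers_periodic (q : nat) : q \in qs ->
  periodic (e * q)%N [pred i | (q %| i)%N && coprime e i].
Proof.
move=> q_qs i /=; rewrite (periodic_dvdl (dvdn_mull e (dvdnn q)) (@periodic_dvdn q)).
by rewrite (periodic_dvdl (dvdn_mulr q (dvdnn e)) (@periodic_coprime e)).
Qed.

Lemma sifted_set_not_prim_root (x : F) :
  x \in sifted_set -> ~~ m.-primitive_root x -> has (fun q => x \in sifted_powers q) qs.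
Proof.
move=> /[dup] /exp_set_exp[i ->].
rewrite (mem_exp_set g_prim) => [ei|]; last exact: periodic_dvdl e_dvd (@periodic_coprime e).
rewrite (prim_root_exp_coprime i g_prim) => im.
have /hasP[q q_qs qi] := sieve_split_has_dvdn m_gt0 split ei im.
apply/hasP; exists q; rewrite // (mem_exp_set g_prim) /= ?qi //.
exact: periodic_dvdl (eq_dvd q_qs) (sifted_powers_periodic q_qs).
Qed.

Lemma sum_count_sifted_cover :
  {in I &, forall y z, ~~ m.-primitive_root (y + z)} ->
  (sum_count I sifted_set <= \sum_(q <- qs) sum_count I (sifted_powers q))%N.
Proof.
move=> no_prim; rewrite [leqRHS]exchange_big; apply: leq_sum => y yI.
rewrite [leqRHS]exchange_big; apply: leq_sum => z zI.
case yz: (_ \in sifted_set) => //.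
have /hasP[q q_qs yzq] := sifted_set_not_prim_root yz (no_prim y z yI zI).
by rewrite (big_rem q) //= yzq.
Qed.

Let main_term : algC := #|I|%:R ^+ 2 * (m%:R * (totient e)%:R / e%:R).
Let error_term : algC := sqrtC (#|F| * totient e)%:R * (#|I|%:R * m%:R).

Lemma sum_count_exp_set_approx (P : pred nat) (D : nat) : (D %| m)%N -> periodic D P ->
  (\sum_(0 <= i < D) P i = totient e)%N ->
  `| #|F|%:R * (sum_count I (exp_set g P))%:R
     - #|I|%:R ^+ 2 * (m%:R * (totient e)%:R / D%:R) | <= error_term.
Proof.
move=> Dm per sumP; have := exp_set_sum_count_bound g_prim I Dm per sumP.
rewrite natrM natf_div // [_ / D%:R * _]mulrAC => /le_trans; apply.
rewrite ler_wpM2l ?sqrtC_ge0 // expr2 [_ * #|I|%:R]mulrC -mulrBr.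
have FE : #|F|%:R = m%:R + 1 :> algC.
  by rewrite natr1 prednK // ltnW // finNzRing_gt1.
have [->|I0] := posnP #|I|; first by rewrite !mul0r.
by rewrite ler_wpM2l // FE lerBlDr lerD2l ler1n.
Qed.

Lemma sum_count_sifted_set_ge : main_term - error_term <= #|F|%:R * (sum_count I sifted_set)%:R.
Proof.
apply: real_ler_distlCBl; first by rewrite rpredB ?rpredM ?rpredX ?rpredV ?realn.
apply: sum_count_exp_set_approx e_dvd (@periodic_coprime e) _.
by rewrite totient_count_coprime.
Qed.

Lemma sum_count_sifted_powers_le (q : nat) : q \in qs ->
  #|F|%:R * (sum_count I (sifted_powers q))%:R <= main_term * q%:R^-1 + error_term.
Proof.
move=> q_qs; have -> : main_term * q%:R^-1 =
    #|I|%:R ^+ 2 * (m%:R * (totient e)%:R / (e * q)%:R).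
  by rewrite /main_term natrM invfM !mulrA.
apply: real_ler_distlDr; first by rewrite rpredB ?rpredM ?rpredX ?rpredV ?realn.
apply: sum_count_exp_set_approx (eq_dvd q_qs) (sifted_powers_periodic q_qs) _.
by rewrite sum_multiples_coprime ?coprime_eq // (dvdn_gt0 m_gt0 (q_dvd q_qs)).
Qed.

Lemma sieve_inequality :
  {in I &, forall y z, ~~ m.-primitive_root (y + z)} ->
  main_term * (1 - \sum_(q <- qs) q%:R^-1) <= (size qs).+1%:R * error_term.
Proof.
move=> /sum_count_sifted_cover cover.
have : main_term - error_term <= \sum_(q <- qs) (main_term * q%:R^-1 + error_term).
  apply: le_trans sum_count_sifted_set_ge _.
  apply: (@le_trans _ _ (#|F|%:R * (\sum_(q <- qs) sum_count I (sifted_powers q))%:R)).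
    by rewrite ler_wpM2l ?ler_nat.
  rewrite natr_sum mulr_sumr big_seq [leRHS]big_seq.
  by apply: ler_sum => q; apply: sum_count_sifted_powers_le.
rewrite big_split /= -mulr_sumr big_const_seq iter_addr_0 count_predT.
by rewrite mulrBr mulr1 mulr_natl mulrSr lerBlDr lerBlDl addrA.
Qed.

Lemma sieve_card_le (d : nat) : {in I &, forall y z, ~~ m.-primitive_root (y + z)} ->
  (0 < d)%N -> \sum_(q <- qs) q%:R^-1 <= 1 - d%:R^-1 :> algC ->
  (#|I| ^ 2 * totient e <= ((size qs).+1 * d * e) ^ 2 * #|F|)%N.
Proof.
move=> /sieve_inequality ineq d_gt0 sum_qs.
have [->|I_gt0] := posnP #|I|; first by rewrite mul0n.
set phi := totient e; set s := (size qs).+1; set kappa : algC := sqrtC (#|F| * phi)%:R.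
have [d_neq0 e_neq0] : d%:R != 0 :> algC /\ e%:R != 0 :> algC.
  by rewrite !pnatr_eq0 -!lt0n.
have : #|I|%:R * phi%:R <= (s * d * e)%:R * kappa.
  have pos : 0 < #|I|%:R * m%:R / (d * e)%:R :> algC.
    by rewrite divr_gt0 ?mulr_gt0 ?ltr0n // muln_gt0 d_gt0.
  rewrite -(ler_pM2l pos).
  have -> : #|I|%:R * m%:R / (d * e)%:R * (#|I|%:R * phi%:R) = main_term * d%:R^-1.
    by rewrite natrM /main_term -/phi; field; rewrite d_neq0 e_neq0.
  have -> : #|I|%:R * m%:R / (d * e)%:R * ((s * d * e)%:R * kappa) = s%:R * error_term.
    by rewrite !natrM /error_term -/phi -/kappa; field; rewrite d_neq0 e_neq0.
  apply: le_trans ineq; rewrite ler_wpM2l ?mulr_ge0 ?exprn_ge0 ?invr_ge0 //.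
  by rewrite lerBrDl -lerBrDr.
rewrite -(@ler_pXn2r _ 2) ?nnegrE ?mulr_ge0 ?sqrtC_ge0 // !exprMn sqrtCK.
rewrite -!natrX -!natrM ler_nat -(mulnn phi) !mulnA leq_pmul2r //.
by rewrite totient_gt0.
Qed.

End PrimitiveRootSieve.

Lemma sumset_prim_root (F : finFieldType) (I : {set F}) (e d : nat) (qs : seq nat) :
  sieve_split #|F|.-1 e qs -> (0 < d)%N ->
  \sum_(q <- qs) q%:R^-1 <= 1 - d%:R^-1 :> algC ->
  (((size qs).+1 * d * e) ^ 2 * #|F| < #|I| ^ 2 * totient e)%N ->
  exists y z, [/\ y \in I, z \in I & (#|F|.-1).-primitive_root (y + z)].
Proof.
move=> split d_gt0 sum_qs; rewrite ltnNge => big.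
have [/exists_inP[y yI /exists_inP[z zI yz]]|no_prim] :=
  boolP [exists y in I, exists z in I, (#|F|.-1).-primitive_root (y + z)]; first by exists y, z.
have [g g_prim] := finField_prim_root F.
case/negP: big; apply: (sieve_card_le g_prim split) => // y z yI zI.
apply: contra no_prim => yz.
by apply/exists_inP; exists y => //; apply/exists_inP; exists z.
Qed.

Lemma Fp_sumset_prim_root (p e d N : nat) (qs : seq nat) :
  prime p -> sieve_split p.-1 e qs -> (0 < d)%N -> (N < p)%N ->
  \sum_(q <- qs) q%:R^-1 <= 1 - d%:R^-1 :> rat ->
  (((size qs).+1 * d * e) ^ 2 * p < N ^ 2 * totient e)%N ->
  exists2 h, (0 < h <= N.*2)%N & (p.-1).-primitive_root (h%:R : 'F_p).
Proof.
move=> p_prime split d_gt0 Np sum_qs big.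
pose I : {set 'F_p} := [set i.+1%:R | i : 'I_N].
have card_I : #|I| = N.
  rewrite card_imset ?card_ord // => i j /(congr1 val) /=.
  rewrite !val_Fp_nat // => /eqP.
  by rewrite !modn_small ?(leq_ltn_trans (ltn_ord _)) // => /eqP[/val_inj].
have := @sumset_prim_root _ I e d qs; rewrite card_Fp // card_I.
have sum_qsC : \sum_(q <- qs) q%:R^-1 <= 1 - d%:R^-1 :> algC.
  move: sum_qs; rewrite -(ler_rat algC) rmorph_sum rmorphB rmorph1 fmorphV rmorph_nat.
  by under eq_bigr do rewrite fmorphV rmorph_nat.
case/(_ split d_gt0 sum_qsC big) => _ [_ [/imsetP[i _ ->] /imsetP[j _ ->] ij]].
by exists (i.+1 + j.+1)%N; rewrite ?natrD // -addnn leq_add.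
Qed.

Local Close Scope ring_scope.

(* The largest [N] with [N.*2 ^ k < x] is at least 10, hence [5 * (2 * N + 2) <= 11 * N]. *)
Lemma exists_half_root_approx (k x : nat) : 0 < k -> 20 ^ k < x ->
  exists2 N, N.*2 ^ k < x & 5 ^ k * x <= (11 * N) ^ k.
Proof.
move=> k_gt0 x_big.
have ex : exists N, N.*2 ^ k < x by exists 10.
have bounded N : N.*2 ^ k < x -> N <= x.
  case: N => // N lt_x; apply: leq_trans (ltnW lt_x).
  apply: (@leq_trans (N.+1.*2 ^ 1)); first by rewrite expn1 -addnn leq_addr.
  by rewrite leq_pexp2l.
have [N ltN maxN] := ex_maxnP ex bounded; exists N => //.
have N_ge10 : 10 <= N by apply: maxN.
have x_le : x <= N.+1.*2 ^ k by rewrite leqNgt; apply/negP => /maxN; rewrite ltnn.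
apply: (@leq_trans (5 ^ k * N.+1.*2 ^ k)); first by rewrite leq_mul2l x_le orbT.
by rewrite -expnMn leq_exp2r //; lia.
Qed.

Lemma sqr_mul_lt_of_pow8 (a b f N X p : nat) : 0 < a -> 0 < p ->
  b ^ 8 * p ^ 5 <= (a * N) ^ 8 -> (a * X) ^ 8 < b ^ 8 * (p * f ^ 4) ->
  X ^ 2 * p < N ^ 2 * f.
Proof.
move=> a_gt0 p_gt0 N_big X_small.
have pow4 x y : (x ^ 2 * y) ^ 4 = x ^ 8 * y ^ 4 by rewrite expnMn -expnM.
have mul_pow8 x y : a ^ 8 * (x ^ 8 * y) = (a * x) ^ 8 * y by rewrite mulnA -expnMn.
rewrite -(@ltn_exp2r _ _ 4) // !pow4 -(@ltn_pmul2l (a ^ 8)) ?expn_gt0 ?a_gt0 // !mul_pow8.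
apply: (@leq_trans (b ^ 8 * p ^ 5 * f ^ 4)); last by rewrite leq_mul2r N_big orbT.
have -> : b ^ 8 * p ^ 5 * f ^ 4 = b ^ 8 * (p * f ^ 4) * p ^ 4 by ring.
by rewrite ltn_pmul2r // expn_gt0 p_gt0.
Qed.

Definition has_small_prim_root (p : nat) : Prop :=
  exists h : nat, [/\ 0 < h, h ^ 8 < p ^ 5 & ((p.-1).-primitive_root (h%:R : 'F_p))%R].

Lemma sieve_small_prim_root (p e d : nat) (qs : seq nat) :
  prime p -> 20 ^ 8 < p ^ 5 -> sieve_split p.-1 e qs -> 0 < d ->
  (\sum_(q <- qs) q%:R^-1 <= 1 - d%:R^-1 :> rat)%R ->
  (11 * ((size qs).+1 * d * e)) ^ 8 < 5 ^ 8 * (p * totient e ^ 4) ->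
  has_small_prim_root p.
Proof.
move=> p_prime p_big split d_gt0 sum_qs big; have p_gt0 := prime_gt0 p_prime.
have [N ltN N_big] := exists_half_root_approx (isT : 0 < 8) p_big.
have Np : N < p.
  have : N.*2 ^ 8 < p ^ 8 by apply: leq_trans ltN _; rewrite leq_exp2l ?prime_gt1.
  by rewrite ltn_exp2r //; apply: leq_ltn_trans; rewrite -addnn leq_addr.
have sieve_wins := sqr_mul_lt_of_pow8 (isT : 0 < 11) p_gt0 N_big big.
have [h /andP[h_gt0 hN] h_prim] := Fp_sumset_prim_root p_prime split d_gt0 Np sum_qs sieve_wins.
by exists h; split=> //; apply: leq_ltn_trans ltN; rewrite leq_exp2r.
Qed.

(** * Products of distinct primes *)

Lemma dvdn_prod_primes (s : seq nat) (q : nat) :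
  all prime s -> prime q -> (q %| \prod_(r <- s) r) = (q \in s).
Proof.
move=> /allP s_prime q_prime; rewrite Euclid_dvd_prod // big_has.
apply/hasP/idP => [[r rs]|qs]; last by exists q.
by rewrite (dvdn_prime2 q_prime (s_prime r rs)) => /eqP->.
Qed.

Lemma totient_prod_primes (s : seq nat) :
  uniq s -> all prime s -> totient (\prod_(q <- s) q) = \prod_(q <- s) q.-1.
Proof.
elim: s => [|q s IHs] /=; first by rewrite !big_nil.
move=> /andP[qs s_uniq] /andP[q_prime s_prime]; rewrite !big_cons totient_coprime.
  by rewrite totient_prime // IHs.
by rewrite prime_coprime // dvdn_prod_primes.
Qed.

Lemma prod_primes_dvdn (m : nat) : 0 < m -> \prod_(q <- primes m) q %| m.
Proof.
move=> m_gt0; rewrite [X in _ %| X]prod_prime_decomp // prime_decompE big_map /=.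
rewrite big_seq [X in _ %| X]big_seq.
apply: (big_ind2 dvdn) => // [a b c d|q]; first exact: dvdn_mul.
by rewrite -logn_gt0 => q_m; rewrite dvdn_exp.
Qed.

Lemma all_prime_primes (m : nat) : all prime (primes m).
Proof. by apply/allP => q; rewrite mem_primes => /andP[]. Qed.

Lemma sieve_split_primes (m : nat) (small large : seq nat) :
  0 < m -> perm_eq (small ++ large) (primes m) ->
  sieve_split m (\prod_(q <- small) q) large.
Proof.
move=> m_gt0 split; have := all_prime_primes m; have := primes_uniq m.
rewrite -(perm_uniq split) -(perm_all _ split) cat_uniq all_cat.
case/and3P=> _ /hasPn disj _ /andP[small_prime /allP large_prime].
split=> [|q q_large|q q_prime qm].
- apply: dvdn_trans (prod_primes_dvdn m_gt0).
  by rewrite -(perm_big _ split) big_cat dvdn_mulr.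
- have q_prime := large_prime q q_large.
  rewrite coprime_sym prime_coprime // dvdn_prod_primes // disj // andbT.
  by have := mem_cat q small large; rewrite (perm_mem split) q_large orbT mem_primes => /and3P[].
- by rewrite dvdn_prod_primes // -mem_cat (perm_mem split) mem_primes q_prime m_gt0.
Qed.

(** * At most 41 prime factors *)

Lemma ler_natV (R : numFieldType) (a b : nat) :
  0 < a -> a <= b -> (b%:R^-1 <= a%:R^-1 :> R)%R.
Proof.
by move=> a_gt0 ab; rewrite lef_pV2 ?posrE ?ltr0n ?(leq_trans a_gt0) // ler_nat.
Qed.

(* Subtracting [c] from each [f x] makes the terms over [t] nonnegative and those over
   [s] outside [t] nonpositive. *)
Lemma ler_sum_exchange (R : numDomainType) (T : eqType) (f : T -> R) (c : R) (s t : seq T) :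
  uniq s -> uniq t -> (0 <= c)%R -> {in t, forall x, (c <= f x)%R} ->
  {in s, forall x, x \notin t -> (f x <= c)%R} -> size s <= size t ->
  (\sum_(x <- s) f x <= \sum_(x <- t) f x)%R.
Proof.
move=> s_uniq t_uniq c_ge0 t_ge s_le st.
have sum_shift u : (\sum_(x <- u) (f x - c) = \sum_(x <- u) f x - c *+ size u)%R.
  by rewrite big_split /= big_const_seq iter_addr_0 count_predT mulNrn.
have : (\sum_(x <- s) (f x - c) <= \sum_(x <- t) (f x - c))%R.
  rewrite (bigID (mem t)) /= [leRHS](bigID (mem s)) /= lerD //.
    rewrite -big_filter -[leRHS]big_filter (perm_big [seq x <- t | x \in s]) //=.
    by rewrite uniq_perm ?filter_uniq // => x; rewrite !mem_filter andbC.
  apply: (@le_trans _ _ 0%R); rewrite big_seq_cond.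
    by apply: sumr_le0 => x /andP[xs xt]; rewrite subr_le0 s_le.
  by apply: sumr_ge0 => x /andP[xt _]; rewrite subr_ge0 t_ge.
rewrite !sum_shift lerBlDr => /le_trans; apply.
by rewrite -addrA gerDl addrC subr_le0 ler_wpMn2l.
Qed.

Lemma sum_inv_primes_7_191 :
  (\sum_(q <- [seq q <- iota 7 185 | prime q]) q%:R^-1 <= 1 - 11%:R^-1 :> rat)%R.
Proof.
have -> : [seq q <- iota 7 185 | prime q] = [:: 7; 11; 13; 17; 19; 23; 29; 31; 37; 41;
  43; 47; 53; 59; 61; 67; 71; 73; 79; 83; 89; 97; 101; 103; 107; 109; 113; 127; 131; 137;
  139; 149; 151; 157; 163; 167; 173; 179; 181; 191] by vm_compute.
rewrite !big_cons big_nil; lra.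
Qed.

Lemma sum_inv_primes_gt5 (s : seq nat) :
  uniq s -> {in s, forall q, prime q && (5 < q)} -> size s <= 40 ->
  (\sum_(q <- s) q%:R^-1 <= 1 - 11%:R^-1 :> rat)%R.
Proof.
move=> s_uniq s_prime s_size; apply: le_trans sum_inv_primes_7_191.
apply: (@ler_sum_exchange _ _ (fun q => q%:R^-1)%R (192%:R^-1)%R s _ s_uniq).
- by rewrite filter_uniq ?iota_uniq.
- by rewrite invr_ge0 ler0n.
- by move=> q; rewrite mem_filter mem_iota => /and3P[_ q_ge7 q_lt192]; apply: ler_natV; lia.
- move=> q /s_prime/andP[q_prime q_gt5]; rewrite mem_filter q_prime mem_iota => q_far.
  have q_neq6 : q != 6 by apply: contraTneq q_prime => ->.
  by apply: ler_natV => //; lia.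
- exact: leq_trans s_size _.
Qed.

Lemma filter_le_primes (m n : nat) : 0 < m ->
  [seq q <- primes m | q <= n] = [seq q <- iota 0 n.+1 | prime q && (q %| m)].
Proof.
move=> m_gt0; apply: (irr_sorted_eq ltn_trans ltnn).
- exact: sorted_filter ltn_trans _ _ (sorted_primes m).
- exact: sorted_filter ltn_trans _ _ (iota_ltn_sorted _ _).
by move=> q; rewrite !mem_filter mem_primes mem_iota m_gt0 ltnS andbC.
Qed.

(* The ratio [e ^ 2 / totient e] is largest for [e = 30], where it is [900 / 8]. *)
Lemma sqr_le_totient_prod_primes_le5 (m : nat) : 0 < m ->
  let e := \prod_(q <- [seq q <- primes m | q <= 5]) q in 8 * e ^ 2 <= 900 * totient e.
Proof.
move=> m_gt0; rewrite filter_le_primes //=.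
by case: (2 %| m); case: (3 %| m); case: (5 %| m); rewrite /= ?big_cons big_nil.
Qed.

Lemma pow8_lt_of_sqr_le (a b c d e f p : nat) : 0 < b -> 0 < f ->
  b * e ^ 2 <= c * f -> a ^ 8 * c ^ 4 < d * b ^ 4 * p -> (a * e) ^ 8 < d * (p * f ^ 4).
Proof.
move=> b_gt0 f_gt0 e2f p_big; rewrite -(@ltn_pmul2l (b ^ 4)) ?expn_gt0 ?b_gt0 //.
apply: (@leq_ltn_trans (a ^ 8 * c ^ 4 * f ^ 4)).
  have -> : b ^ 4 * (a * e) ^ 8 = a ^ 8 * (b * e ^ 2) ^ 4 by ring.
  by rewrite -mulnA -expnMn leq_mul2l leq_exp2r // e2f orbT.
have -> : b ^ 4 * (d * (p * f ^ 4)) = d * b ^ 4 * p * f ^ 4 by ring.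
by rewrite ltn_pmul2r // expn_gt0 f_gt0.
Qed.

(* [4961 = 11 * 41 * 11] *)
Lemma pow8_lt_few_primes (e f p r : nat) : 0 < f -> 8 * e ^ 2 <= 900 * f ->
  267 * 10 ^ 30 < p -> r <= 41 -> (11 * (r * 11 * e)) ^ 8 < 5 ^ 8 * (p * f ^ 4).
Proof.
move=> f_gt0 e2f p_big r_le41; apply: (@leq_ltn_trans ((4961 * e) ^ 8)).
  by rewrite leq_exp2r // mulnA leq_mul2r; apply/orP; right; clear -r_le41; lia.
apply: (pow8_lt_of_sqr_le (isT : 0 < 8) f_gt0 e2f).
apply: (@leq_ltn_trans (5 ^ 8 * 8 ^ 4 * (267 * 10 ^ 30))); first by clear; lia.
by rewrite ltn_pmul2l.
Qed.

Lemma expn20_8_lt_expn5 (p : nat) : 267 * 10 ^ 30 < p -> 20 ^ 8 < p ^ 5.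
Proof.
move=> p_big; have p_gt : 20 ^ 8 < p by apply: leq_ltn_trans p_big; lia.
by apply: leq_trans p_gt _; rewrite -{1}[p]expn1 leq_pexp2l // (leq_ltn_trans _ p_big).
Qed.

Lemma dvdn2_pred_prime (p : nat) : prime p -> 2 < p -> 2 %| p.-1.
Proof.
move=> p_prime p_gt2; rewrite -subn1 dvdn2 oddB ?prime_gt0 //.
by case: (even_prime p_prime) p_gt2 => [->//|->].
Qed.

Lemma small_prim_root_few_primes (p : nat) :
  prime p -> 267 * 10 ^ 30 < p -> size (primes p.-1) <= 41 -> has_small_prim_root p.
Proof.
move=> p_prime p_big; set m := p.-1 => few_primes.
have p_gt2 : 2 < p by apply: leq_ltn_trans p_big; lia.
have m_gt0 : 0 < m by rewrite /m; lia.
pose small := [seq q <- primes m | q <= 5].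
pose large := [seq q <- primes m | ~~ (q <= 5)].
have split : perm_eq (small ++ large) (primes m) by rewrite perm_filterC.
have size_large : size large <= 40.
  rewrite -ltnS; apply: leq_trans few_primes.
  rewrite -(perm_size split) size_cat -add1n leq_add2r size_filter -has_count.
  by apply/hasP; exists 2; rewrite // mem_primes m_gt0 dvdn2_pred_prime.
have sieve := sieve_split_primes m_gt0 split; have [e_dvd _ _] := sieve.
apply: (sieve_small_prim_root p_prime (expn20_8_lt_expn5 p_big) sieve (isT : 0 < 11)).
- apply: sum_inv_primes_gt5 => // [|q]; first by rewrite filter_uniq ?primes_uniq.
  by rewrite mem_filter mem_primes -ltnNge => /and3P[-> ->].
apply: (pow8_lt_few_primes _ _ p_big) => //; last exact: sqr_le_totient_prod_primes_le5.
by rewrite totient_gt0 (dvdn_gt0 m_gt0 e_dvd).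
Qed.

(** * At least 42 prime factors *)

(* Lower bounds [1, 1, 4, 7, 10, ...] for the primes [2, 3, 5, 7, 11, ...]. *)
Definition nth_prime_lb (i : nat) : nat := (3 * i.-1).+1.

Lemma prime_gt3_mod (q : nat) : prime q -> 3 < q -> (q %% 2 != 0) && (q %% 3 != 0).
Proof. by move=> q_prime q_gt3; rewrite -!/(dvdn _ _) !dvdn_prime2 //; lia. Qed.

(* Three integers coprime to 6 span at least 6. *)
Lemma nth_primes_ge (s : seq nat) (i : nat) :
  sorted ltn s -> all prime s -> i < size s -> nth_prime_lb i <= nth 0 s i.
Proof.
move=> s_sorted /allP s_prime.
have nth_prime k : k < size s -> prime (nth 0 s k) by move=> ks; rewrite s_prime ?mem_nth.
have nthS k : k.+1 < size s -> nth 0 s k < nth 0 s k.+1 by exact: (sortedP 0 s_sorted).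
have nth_gt3 k : k.+2 < size s -> 3 < nth 0 s k.+2.
  elim: k => [s2|k IHk ks]; last exact: ltn_trans (IHk (ltnW ks)) (nthS _ ks).
  have := prime_gt1 (nth_prime _ (ltnW (ltnW s2))); have := nthS _ (ltnW s2).
  by have := nthS _ s2; clear; lia.
have nth_mod k (ks : k.+2 < size s) := prime_gt3_mod (nth_prime _ ks) (nth_gt3 _ ks).
rewrite /nth_prime_lb; elim/ltn_ind: i => -[|[|[|[|i]]]] IHi lt_i.
- by rewrite prime_gt0 ?nth_prime.
- by rewrite prime_gt0 ?nth_prime.
- exact: nth_gt3.
- have := nth_gt3 0 (ltnW lt_i); have := nth_mod 0 (ltnW lt_i); have := nth_mod 1 lt_i.
  by have := nthS 2 lt_i; clear; lia.
have lt_i3 := ltnW lt_i; have lt_i2 := ltnW lt_i3.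
have := IHi i.+2 _ lt_i2; have := nthS _ lt_i3; have := nthS _ lt_i.
have := nth_mod _ lt_i2; have := nth_mod _ lt_i3; have := nth_mod _ lt_i.
by clear; lia.
Qed.

Lemma prod_le_prod_pred_path (a : nat) (s : seq nat) : path ltn a s ->
  a * \prod_(q <- s) q <= (a + size s) * \prod_(q <- s) q.-1.
Proof.
elim: s a => [|q s IHs] a /=; first by rewrite !big_nil addn0.
case/andP=> aq /IHs; rewrite !big_cons.
move: (\prod_(r <- s) r) (\prod_(r <- s) r.-1) => u v uv.
apply: (@leq_trans (a * ((q + size s) * v))); first by rewrite leq_mul2l uv orbT.
rewrite !mulnA leq_mul2r; apply/orP; right.
by case: q aq {uv} => // q aq /=; nia.
Qed.

Lemma exp_size_le_prod (a : nat) (s : seq nat) :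
  all (leq a) s -> a ^ size s <= \prod_(q <- s) q.
Proof.
elim: s => [|q s IHs] /=; first by rewrite big_nil.
by case/andP=> aq /IHs s_ge; rewrite big_cons expnS leq_mul.
Qed.

Lemma prod_exp_le_prod (c : nat) (s t : seq nat) :
  allrel leq s t -> all (ltn 0) t -> c * size s <= size t ->
  (\prod_(q <- s) q) ^ c <= \prod_(q <- t) q.
Proof.
elim: s t => [|x s IHs] t /=.
  by move=> _ t_gt0 _; have := exp_size_le_prod t_gt0; rewrite big_nil !exp1n.
rewrite allrel_consl => /andP[xt st] t_gt0; rewrite mulnS => size_t.
rewrite big_cons expnMn -(cat_take_drop c t) big_cat leq_mul //.
  have {1}<- : size (take c t) = c.
    by apply: size_takel; apply: leq_trans size_t; apply: leq_addr.
  by apply: exp_size_le_prod; apply/allP => y /mem_take; apply/allP.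
apply: IHs.
- by apply/allrelP => y z ys /mem_drop; apply/allrelP: y z ys.
- by apply/allP => y /mem_drop; apply/allP.
- by rewrite size_drop leq_subRL // (leq_trans _ size_t) ?leq_addr.
Qed.

Lemma prod_take_exp_le (c k : nat) (s : seq nat) :
  sorted leq s -> all (ltn 0) s -> c.+1 * k <= size s ->
  (\prod_(q <- take k s) q) ^ c.+1 <= \prod_(q <- s) q.
Proof.
rewrite sorted_pairwise; last exact: leq_trans.
rewrite -{1 2 5}(cat_take_drop k s) pairwise_cat all_cat big_cat expnS mulSn.
case/and3P=> small_large _ _ /andP[_ large_gt0] ks.
rewrite leq_mul2l prod_exp_le_prod ?orbT // size_take_min size_drop.
by rewrite (minn_idPl _); lia.
Qed.

(* Equivalent to [(1 + 1 / n) ^ t <= n / (n - t)]. *)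
Lemma subn_mul_expSn_le (n t : nat) : (n - t) * n.+1 ^ t <= n * n ^ t.
Proof.
elim: t => [|t IHt]; first by rewrite subn0 !expn0.
rewrite expnS mulnA; apply: (@leq_trans (n * (n - t) * n.+1 ^ t)).
  by rewrite leq_mul2r; apply/orP; right; nia.
by rewrite -mulnA [n ^ t.+1]expnS leq_mul2l IHt orbT.
Qed.

Lemma expSn_le_triple (n t : nat) : 0 < n -> 3 * t <= 2 * n -> n.+1 ^ t <= 3 * n ^ t.
Proof.
move=> n_gt0 tn; rewrite -(leq_pmul2l n_gt0) mulnCA.
apply: leq_trans (leq_mul (leqnn 3) (subn_mul_expSn_le n t)).
by rewrite mulnA leq_mul2r; apply/orP; right; lia.
Qed.

Lemma prod_nth_prime_lb_ge (n : nat) : 42 <= n ->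
  11 ^ 19 * n ^ 28 <= \prod_(0 <= i < n) nth_prime_lb i.
Proof.
move=> /subnKC <-; elim: (n - 42) => [|k IHk].
  by rewrite addn0 /nth_prime_lb unlock /=; lia.
rewrite addnS big_nat_recr //=; apply: leq_trans (leq_mul IHk (leqnn _)).
rewrite -mulnA leq_mul2l; apply/orP; right.
apply: leq_trans (@expSn_le_triple (42 + k) 28 _ _) _; [by [] | by clear; lia |].
by rewrite mulnC leq_mul2l /nth_prime_lb; apply/orP; right; clear; lia.
Qed.

Lemma sum_inv_nth_prime_lb_6_49 :
  (\sum_(6 <= i < 49) (nth_prime_lb i)%:R^-1 <= 4%:R / 5%:R :> rat)%R.
Proof.
rewrite -(big_map nth_prime_lb xpredT (fun a => a%:R^-1)%R).
have -> : [seq nth_prime_lb i | i <- index_iota 6 49] = [:: 16; 19; 22; 25; 28; 31; 34;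
  37; 40; 43; 46; 49; 52; 55; 58; 61; 64; 67; 70; 73; 76; 79; 82; 85; 88; 91; 94; 97; 100;
  103; 106; 109; 112; 115; 118; 121; 124; 127; 130; 133; 136; 139; 142] by [].
rewrite !big_cons big_nil; lra.
Qed.

(* Each step drops one term and adds seven terms, each at most a seventh of it. *)
Lemma sum_inv_nth_prime_lb (k : nat) : 6 <= k ->
  (\sum_(k <= i < 7 * k.+1) (nth_prime_lb i)%:R^-1 <= 4%:R / 5%:R :> rat)%R.
Proof.
elim: k => [//|k IHk]; rewrite leq_eqVlt => /orP[/eqP <-|k_ge6].
  exact: sum_inv_nth_prime_lb_6_49.
have k_gt0 : 0 < k by clear -k_ge6; lia.
apply: le_trans (IHk k_ge6).
rewrite (@big_cat_nat _ _ _ (7 * k.+1)) /=; [|by clear; lia|by clear; lia].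
rewrite [leRHS]big_ltn; last by clear; lia.
rewrite addrC lerD2r.
apply: (@le_trans _ _ (\sum_(7 * k.+1 <= i < 7 * k.+2) (7 * nth_prime_lb k)%:R^-1)%R).
  rewrite big_nat [leRHS]big_nat; apply: ler_sum => i /andP[ki _].
  by apply: ler_natV => //; rewrite /nth_prime_lb; clear -ki k_gt0; lia.
rewrite sumr_const_nat -mulnBr subSnn muln1 natrM invfM -mulrnAl.
by rewrite -(mulr_natr 7%:R^-1)%R mulVf ?mul1r.
Qed.

Lemma sum_inv_drop_primes (k : nat) (s : seq nat) : sorted ltn s -> all prime s ->
  (\sum_(q <- drop k s) q%:R^-1 <=
     \sum_(k <= i < size s) (nth_prime_lb i)%:R^-1 :> rat)%R.
Proof.
move=> s_sorted s_prime.
rewrite (big_nth 0) size_drop -[X in (_ <= \sum_(X <= _ < _) _)%R]add0n big_addn.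
rewrite big_nat [leRHS]big_nat; apply: ler_sum => i /andP[_ ik].
rewrite nth_drop addnC; apply: ler_natV => //; apply: nth_primes_ge => //.
by clear -ik; lia.
Qed.

Lemma sum_inv_drop_primes_le (k : nat) (s : seq nat) : sorted ltn s -> all prime s ->
  6 <= k -> size s <= 7 * k.+1 ->
  (\sum_(q <- drop k s) q%:R^-1 <= 1 - 5%:R^-1 :> rat)%R.
Proof.
move=> s_sorted s_prime k_ge6 size_s; apply: (@le_trans _ _ (4%:R / 5%:R)%R); last by lra.
apply: le_trans (sum_inv_drop_primes k s_sorted s_prime) _.
apply: le_trans (sum_inv_nth_prime_lb k_ge6).
have [sk|ks] := leqP (size s) k.
  by rewrite big_geq // sumr_ge0 // => i _; rewrite invr_ge0.
rewrite [leRHS](@big_cat_nat _ _ _ (size s)) ?(ltnW ks) //= lerDl.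
by rewrite sumr_ge0 // => i _; rewrite invr_ge0.
Qed.

(* Raise to the seventh power and use [e ^ 28 <= p ^ 4] and [(a ^ 19 * n ^ 28) ^ 3 <= p ^ 3]. *)
Lemma pow8_pow12_pow4_lt (a e n p : nat) : 1 < a -> 0 < n ->
  e ^ 7 <= p -> a ^ 19 * n ^ 28 <= p -> a ^ 8 * n ^ 12 * e ^ 4 < p.
Proof.
move=> a_gt1 n_gt0 e7_le an_le; have a_gt0 := ltnW a_gt1.
have p_gt0 : 0 < p by apply: leq_trans an_le; rewrite muln_gt0 !expn_gt0 a_gt0 n_gt0.
rewrite -(@ltn_exp2r _ _ 7) //.
have -> : (a ^ 8 * n ^ 12 * e ^ 4) ^ 7 = a ^ 56 * n ^ 84 * (e ^ 7) ^ 4 by ring.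
apply: (@leq_ltn_trans (a ^ 56 * n ^ 84 * p ^ 4)).
  by rewrite leq_mul2l leq_exp2r // e7_le orbT.
have -> : p ^ 7 = p ^ 3 * p ^ 4 by ring.
rewrite ltn_pmul2r ?expn_gt0 ?p_gt0 //.
apply: (@leq_trans ((a ^ 19 * n ^ 28) ^ 3)); last by rewrite leq_exp2r.
have -> : (a ^ 19 * n ^ 28) ^ 3 = a ^ 57 * n ^ 84 by ring.
by rewrite ltn_pmul2r ?expn_gt0 ?n_gt0 // ltn_exp2l.
Qed.

Lemma pow8_lt_many_primes (a d e f k n p r : nat) : 1 < a -> 0 < d -> 0 < f -> 0 < n ->
  e ^ 7 <= p -> a ^ 19 * n ^ 28 <= p -> e <= k * f -> k <= n -> r <= n ->
  (a * (r * d * e)) ^ 8 < d ^ 8 * (p * f ^ 4).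
Proof.
move=> a_gt1 d_gt0 f_gt0 n_gt0 e7_le an_le e_le kn rn.
have -> : (a * (r * d * e)) ^ 8 = d ^ 8 * (a ^ 8 * r ^ 8 * e ^ 4 * e ^ 4) by ring.
rewrite ltn_pmul2l ?expn_gt0 ?d_gt0 //.
apply: (@leq_ltn_trans (a ^ 8 * n ^ 12 * e ^ 4 * f ^ 4)).
  have -> : a ^ 8 * n ^ 12 * e ^ 4 * f ^ 4 = a ^ 8 * n ^ 8 * e ^ 4 * (n * f) ^ 4 by ring.
  rewrite !leq_mul ?leq_exp2r // (leq_trans e_le) // leq_mul2r kn orbT //.
by rewrite ltn_pmul2r ?expn_gt0 ?f_gt0 // pow8_pow12_pow4_lt.
Qed.

Lemma prod_nth_prime_lb_le (s : seq nat) : sorted ltn s -> all prime s ->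
  \prod_(0 <= i < size s) nth_prime_lb i <= \prod_(q <- s) q.
Proof.
move=> s_sorted s_prime; rewrite [leqRHS](big_nth 0) big_nat [leqRHS]big_nat.
by apply: leq_prod => i /andP[_ lt_i]; apply: nth_primes_ge.
Qed.

Lemma leq_prod_totient (s : seq nat) : sorted ltn s -> all prime s ->
  \prod_(q <- s) q <= (size s).+1 * totient (\prod_(q <- s) q).
Proof.
move=> s_sorted s_prime.
rewrite totient_prod_primes ?(sorted_uniq ltn_trans ltnn) //.
rewrite -[leqLHS]mul1n -add1n; apply: prod_le_prod_pred_path.
rewrite path_min_sorted //; apply: sub_all s_prime => q; exact: prime_gt1.
Qed.

Lemma small_prim_root_many_primes (p : nat) :
  prime p -> 20 ^ 8 < p ^ 5 -> 42 <= size (primes p.-1) -> has_small_prim_root p.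
Proof.
move=> p_prime p_big; set m := p.-1; set s := primes m; set n := size s => n_ge42.
have m_gt0 : 0 < m by rewrite /m -subn1 subn_gt0 prime_gt1.
have s_sorted : sorted ltn s := sorted_primes m.
have s_prime : all prime s := all_prime_primes m.
have prod_s_le : \prod_(q <- s) q <= p.
  by apply: leq_trans (leq_pred p); apply: dvdn_leq (prod_primes_dvdn m_gt0).
pose k := n %/ 7.
have [kn_le kn_gt k_ge6] : [/\ 7 * k <= n, n < 7 * k.+1 & 6 <= k].
  by rewrite /k; clear -n_ge42; split; lia.
have sieve : sieve_split m (\prod_(q <- take k s) q) (drop k s).
  by apply: sieve_split_primes; rewrite ?cat_take_drop.
have [e_dvd _ _] := sieve.
apply: (sieve_small_prim_root p_prime p_big sieve (isT : 0 < 5)).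
  exact: sum_inv_drop_primes_le (ltnW kn_gt).
apply: (@pow8_lt_many_primes _ _ _ _ k.+1 n) => //.
- by rewrite totient_gt0 (dvdn_gt0 m_gt0 e_dvd).
- by clear -n_ge42; lia.
- apply: leq_trans prod_s_le; apply: prod_take_exp_le => //.
    by apply: sub_sorted s_sorted => x y /ltnW.
  by apply: sub_all s_prime => q; exact: prime_gt0.
- apply: leq_trans (prod_nth_prime_lb_ge n_ge42) _.
  exact: leq_trans (prod_nth_prime_lb_le s_sorted s_prime) prod_s_le.
- have size_k : size (take k s) = k by apply: size_takel; clear -kn_le; lia.
  rewrite -{2}size_k; apply: leq_prod_totient; first exact: take_sorted.
  by apply/allP => q /mem_take; apply/allP.
- by clear -kn_le k_ge6; lia.
- by rewrite size_drop; clear -kn_le k_ge6; lia.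
Qed.

Lemma small_prim_root (p : nat) :
  prime p -> 267 * 10 ^ 30 < p -> has_small_prim_root p.
Proof.
move=> p_prime p_big; have [few|many] := leqP (size (primes p.-1)) 41.
  exact: small_prim_root_few_primes.
exact: small_prim_root_many_primes (expn20_8_lt_expn5 p_big) many.
Qed.

(** * Standard library arithmetic *)

Lemma Nat_powE (a n : nat) : Nat.pow a n = a ^ n.
Proof. by elim: n => //= n ->; rewrite expnS. Qed.

Lemma Nat_moduloE (a n : nat) : 0 < n -> Nat.modulo a n = a %% n.
Proof.
move=> n_gt0; symmetry; apply: (PeanoNat.Nat.mod_unique _ _ (a %/ n)).
  by apply/ssrnat.ltP; rewrite ltn_pmod.
by rewrite multE plusE mulnC -divn_eq.
Qed.

Lemma Nat_gcdE (a b : nat) : Nat.gcd a b = gcdn a b.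
Proof.
apply: PeanoNat.Nat.gcd_unique => [||d [x ax] [y bY]].
- exact/dvdnP/dvdn_gcdl.
- exact/dvdnP/dvdn_gcdr.
by apply/dvdnP; rewrite dvdn_gcd; apply/andP; split; apply/dvdnP; [exists x | exists y].
Qed.

Lemma Fp_nat_eq1 (p a : nat) : prime p -> ((a%:R : 'F_p) == 1)%R = (a %% p == 1).
Proof. by move=> p_prime; rewrite -(inj_eq val_inj) /= val_Fp_nat. Qed.

Lemma prim_root_is_primitive_root (p h : nat) : prime p ->
  ((p.-1).-primitive_root (h%:R : 'F_p))%R -> is_primitive_root p h.
Proof.
move=> p_prime h_prim; have p_gt1 := prime_gt1 p_prime; have p_gt0 := prime_gt0 p_prime.
have pow_mod k : (Nat.modulo (Nat.pow h k) p == 1) = (p.-1 %| k).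
  by rewrite Nat_powE Nat_moduloE // -Fp_nat_eq1 // natrX (prim_order_dvd h_prim).
have pow_pred : Nat.modulo (Nat.pow h p.-1) p = 1 by apply/eqP; rewrite pow_mod.
rewrite /is_primitive_root minusE subn1; split; [|split].
- rewrite Nat_gcdE; apply/eqP; rewrite -/(coprime h p) coprime_sym prime_coprime //.
  apply/negP => ph; move: pow_pred.
  by rewrite Nat_powE Nat_moduloE // -modnXm (eqP ph) exp0n ?mod0n // (prim_order_gt0 h_prim).
- by rewrite pow_pred Nat_moduloE // modn_small.
- move=> k /ssrnat.leP k_gt0 /ssrnat.ltP k_lt /eqP; rewrite pow_mod.
  by rewrite gtnNdvd.
Qed.

Lemma exists_primitive_root_lt (p : nat) : prime p -> 267 * 10 ^ 30 < p ->
  exists h, [/\ le 1 h, is_primitive_root p h & lt (Nat.pow h 8) (Nat.pow p 5)].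
Proof.
move=> p_prime /(small_prim_root p_prime)[h [h_gt0 hp h_prim]]; exists h; split.
- exact/ssrnat.leP.
- exact: prim_root_is_primitive_root.
- by rewrite !Nat_powE; apply/ssrnat.ltP.
Qed.

From Stdlib Require Import Arith ZArith Znumtheory Reals.

Lemma prime_of_Zprime (p : nat) : prime (Z.of_nat p) -> prime.prime p.
Proof.
move=> p_prime; have p_ge2 := prime_ge_2 _ p_prime.
apply/primeP; split=> [|d /dvdnP[k pE]]; first by lia.
have /(prime_divisors _ p_prime) : (Z.of_nat d | Z.of_nat p)%Z.
  by exists (Z.of_nat k); rewrite -Nat2Z.inj_mul pE.
by rewrite /=; lia.
Qed.

Lemma INR_lt_Rpower (p h a b : nat) : lt 0 p -> lt 0 b -> lt (Nat.pow h b) (Nat.pow p a) ->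
  (INR h < Rpower (INR p) (INR a / INR b))%R.
Proof.
move=> p_gt0 b_gt0 hp; have p_pos : (0 < INR p)%R by apply: lt_0_INR.
have b_neq0 : INR b <> 0%R by apply: not_0_INR; lia.
apply: Rnot_le_lt => root_le.
have : (Rpower (INR p) (INR a / INR b) ^ b <= INR h ^ b)%R.
  by apply: pow_incr; split=> //; apply: Rlt_le; apply: exp_pos.
rewrite -Rpower_pow; last exact: exp_pos.
rewrite Rpower_mult (_ : INR a / INR b * INR b = INR a)%R; last by field.
by rewrite Rpower_pow // -!pow_INR => /INR_le /Nat.le_ngt.
Qed.

Theorem theorem1 :
  forall p g : nat,
    prime (Z.of_nat p) ->
    (267 * 10 ^ 30 < INR p)%R ->
    least_primitive_root p g ->
    (INR g < Rpower (INR p) (6309 / 10000))%R.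
Proof.
move=> p g p_prime p_big [_ [_ g_least]]; have p_ge2 := prime_ge_2 _ p_prime.
have [|h [h_ge1 h_root hp]] := exists_primitive_root_lt (prime_of_Zprime p_prime).
  by move: p_big; rewrite INR_IZR_INZ pow_IZR -mult_IZR => /lt_IZR; lia.
have g_le_h : (INR g <= INR h)%R.
  by apply: le_INR; apply/Nat.le_ngt => hg; apply: g_least h_root.
have h_lt : (INR h < Rpower (INR p) (INR 5 / INR 8))%R by apply: INR_lt_Rpower hp; lia.
apply: Rle_lt_trans g_le_h _; apply: Rlt_trans h_lt _.
apply: Rpower_lt; first by rewrite -INR_1; apply: lt_INR; lia.
by rewrite /=; Lra.lra.
Qed.
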